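(* Fix $a,b,c\in\{0,1\}$. $\beta$-reduction $\to$ on $abc$-infinitary $\lambda$-terms satisfies property $Q$: for every ordinal $\delta$ and all $abc$-infinitary $\lambda$-terms $s,t,t'$, if $P_\delta$ holds and $s\twoheadrightarrow_\delta t\to t'$, then there is a term $s'$ with $s\to^*s'\twoheadrightarrow_\delta t'$.
   Context: Fix $a,b,c\in\{0,1\}$ and a countable set of variables. $abc$-infinitary $\lambda$-terms are possibly infinite terms generated by $x\mid\lambda x.s\mid st$ in which every infinite branch passes infinitely often through a coinductive position (the body of an abstraction is coinductive iff $a=1$, the function part of an application iff $b=1$, the argument iff $c=1$), taken modulo $\alpha$-equivalence; $s[t/x]$ is capture-avoiding substitution. $\beta$-reduction $\to$ is defined inductively: $(\lambda x.s)t\to s[t/x]$; if $u\to u'$ then $\lambda x.u\to\lambda x.u'$ and $uv\to u'v$; if $v\to v'$ then $uv\to uv'$. $\to^*$ is its reflexive transitive closure. For every ordinal $\gamma$ (by well-founded induction), relations $\twoheadrightarrow_\gamma$, $\overline{\twoheadrightarrow}_\gamma$ are defined by: (split) $s\twoheadrightarrow_\gamma t$ if there are $m\in\mathbb N$, $s'$ with $s\rightsquigarrow^\gamma_ms'$ and $s'\,\overline{\twoheadrightarrow}_\gamma\,t$, where $s\rightsquigarrow^\gamma_ms'$ means there are ordinals $\delta_1,\dots,\delta_m<\gamma$ and terms with $s\to^*s_1'\,\overline{\twoheadrightarrow}_{\delta_1}\,t_1\to^*\cdots\overline{\twoheadrightarrow}_{\delta_m}\,t_m\to^*s'$ (for $m=0$: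 $s\to^*s'$); (lift$_x$) $x\,\overline{\twoheadrightarrow}_\gamma\,x$; (lift$_\lambda$) $\lambda x.u\,\overline{\twoheadrightarrow}_\gamma\,\lambda x.u'$ if $u\twoheadrightarrow_\gamma u'$ (premiss coinductive iff $a=1$); (lift$_@$) $uv\,\overline{\twoheadrightarrow}_\gamma\,u'v'$ if $u\twoheadrightarrow_\gamma u'$ (coinductive iff $b=1$) and $v\twoheadrightarrow_\gamma v'$ (coinductive iff $c=1$). Derivations may be non-wellfounded provided every infinite branch crosses infinitely many coinductive premisses. Property $P_\delta$: for all $n\in\mathbb N$ and terms $s,s'$, if $s\rightsquigarrow^\delta_ns'$ then there are $s''$ and $\epsilon<\delta$ with $s\to^*s''$ and $s''\,(\overline{\twoheadrightarrow}_\epsilon)^*\,s'$ ($(\cdot)^*$ = reflexive transitive closure). *)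

(* Defs.v *)
From Stdlib Require Import FunctionalExtensionality.

Set Implicit Arguments.

(* [R x i y] reads: [y] is an immediate successor of [x], reached through a
   coinductive position iff [i = true]. *)
Definition guarded (X : Type) (R : X -> bool -> X -> Prop) (x : X) : Prop :=
  forall (f : nat -> X) (i : nat -> bool),
    f 0 = x -> (forall n, R (f n) (i n) (f (S n))) ->
    forall n, exists m, n <= m /\ i m = true.

(* De Bruijn indices stand for terms modulo alpha-equivalence; the free
   variables are the indices pointing beyond all enclosing abstractions. *)
CoInductive term : Type :=
| Var (n : nat)
| Lam (u : term)
| App (u v : term).

(* Equality of infinite terms; Leibniz equality on [term] is too fine. *)
CoInductive bisim : term -> term -> Prop :=
| bisim_var n : bisim (Var n) (Var n)
| bisim_lam u u' : bisim u u' -> bisim (Lam u) (Lam u')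
| bisim_app u u' v v' :
    bisim u u' -> bisim v v' -> bisim (App u v) (App u' v').

Definition up_ren (xi : nat -> nat) (n : nat) : nat :=
  match n with 0 => 0 | S k => S (xi k) end.

CoFixpoint ren (xi : nat -> nat) (t : term) : term :=
  match t with
  | Var n => Var (xi n)
  | Lam u => Lam (ren (up_ren xi) u)
  | App u v => App (ren xi u) (ren xi v)
  end.

Definition up (sigma : nat -> term) (n : nat) : term :=
  match n with 0 => Var 0 | S k => ren S (sigma k) end.

CoFixpoint subst (sigma : nat -> term) (t : term) : term :=
  match t with
  | Var n => sigma n
  | Lam u => Lam (subst (up sigma) u)
  | App u v => App (subst sigma u) (subst sigma v)
  end.

(* [subst0 s t] is s[t/x], where [s] is the body of an abstraction over x. *)
Definition subst0 (s t : term) : term :=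
  subst (fun n => match n with 0 => t | S k => Var k end) s.

Inductive beta : term -> term -> Prop :=
| beta_redex s t : beta (App (Lam s) t) (subst0 s t)
| beta_lam u u' : beta u u' -> beta (Lam u) (Lam u')
| beta_fun u u' v : beta u u' -> beta (App u v) (App u' v)
| beta_arg u v v' : beta v v' -> beta (App u v) (App u v').

(* An ordinal is given as an element of a well-ordered type: what is defined
   below at an ordinal only involves the ordinals smaller than it. *)
Record wellorder : Type := WellOrder {
  wo_sort :> Type;
  wo_lt : wo_sort -> wo_sort -> Prop;
  wo_trans : forall x y z, wo_lt x y -> wo_lt y z -> wo_lt x z;
  wo_total : forall x y, wo_lt x y \/ x = y \/ wo_lt y x;
  wo_wf : well_founded wo_lt }.

Section Abc.

Context (a b c : bool).

Inductive subterm : term -> bool -> term -> Prop :=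
| subterm_lam u : subterm (Lam u) a u
| subterm_fun u v : subterm (App u v) b u
| subterm_arg u v : subterm (App u v) c v.

Record abcterm : Type := AbcTerm {
  tm :> term;
  tm_guarded : guarded subterm tm }.

Implicit Types s t u v : abcterm.

(* The relation [beta] on terms up to [bisim]. *)
Definition step s t : Prop :=
  exists s0 t0 : term, bisim s s0 /\ beta s0 t0 /\ bisim t0 t.

(* Reflexive-transitive closure, equality of terms being [bisim]. *)
Inductive star (R : abcterm -> abcterm -> Prop) : abcterm -> abcterm -> Prop :=
| star_refl s t : bisim s t -> star R s t
| star_step s t u : R s t -> star R t u -> star R s u.

Definition steps : abcterm -> abcterm -> Prop := star step.

Context (W : wellorder).

(* In standard notation, at level gamma: [chain] is the squiggly arrow with its
   number of steps, [red] the two-headed arrow and [bar] its overlined variant.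
   Derivations may be infinite; [guarded premiss] constrains their branches. *)
Section Level.

Context (gamma : W).
Context (lower : forall delta : W,
  wo_lt W delta gamma -> abcterm -> abcterm -> Prop).

Inductive chain_of : nat -> abcterm -> abcterm -> Prop :=
| chain_nil s s' : steps s s' -> chain_of 0 s s'
| chain_cons m s s1 t1 s' (delta : W) (h : wo_lt W delta gamma) :
    steps s s1 -> lower delta h s1 t1 -> chain_of m t1 s' -> chain_of (S m) s s'.

CoInductive red_deriv : abcterm -> abcterm -> Type :=
| split m s s' t : chain_of m s s' -> bar_deriv s' t -> red_deriv s t
with bar_deriv : abcterm -> abcterm -> Type :=
| lift_var s t n : tm s = Var n -> tm t = Var n -> bar_deriv s t
| lift_lam s t u u' :
    tm s = Lam u -> tm t = Lam u' -> red_deriv u u' -> bar_deriv s t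
| lift_app s t u u' v v' :
    tm s = App u v -> tm t = App u' v' ->
    red_deriv u u' -> red_deriv v v' -> bar_deriv s t.

Inductive deriv : Type :=
| RedDeriv s t (d : red_deriv s t)
| BarDeriv s t (d : bar_deriv s t).

Inductive premiss : deriv -> bool -> deriv -> Prop :=
| premiss_split m s s' t (h : chain_of m s s') (d : bar_deriv s' t) :
    premiss (RedDeriv (split h d)) false (BarDeriv d)
| premiss_lam s t u u' (es : tm s = Lam u) (et : tm t = Lam u')
    (d : red_deriv u u') :
    premiss (BarDeriv (lift_lam s t es et d)) a (RedDeriv d)
| premiss_fun s t u u' v v' (es : tm s = App u v) (et : tm t = App u' v')
    (d : red_deriv u u') (e : red_deriv v v') :
    premiss (BarDeriv (lift_app s t es et d e)) b (RedDeriv d)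
| premiss_arg s t u u' v v' (es : tm s = App u v) (et : tm t = App u' v')
    (d : red_deriv u u') (e : red_deriv v v') :
    premiss (BarDeriv (lift_app s t es et d e)) c (RedDeriv e).

Definition red_of s t : Prop :=
  exists d : red_deriv s t, guarded premiss (RedDeriv d).

Definition bar_of s t : Prop :=
  exists d : bar_deriv s t, guarded premiss (BarDeriv d).

End Level.

Definition bar : W -> abcterm -> abcterm -> Prop :=
  Fix (wo_wf W) (fun _ => abcterm -> abcterm -> Prop) bar_of.

Definition red (gamma : W) : abcterm -> abcterm -> Prop :=
  red_of gamma (fun delta _ => bar delta).

Definition chain (gamma : W) : nat -> abcterm -> abcterm -> Prop :=
  chain_of gamma (fun delta _ => bar delta).

Lemma bar_unfold (gamma : W) :
  bar gamma = bar_of gamma (fun delta _ => bar delta).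
Proof.
apply (Fix_eq (wo_wf W) (fun _ => abcterm -> abcterm -> Prop) bar_of).
intros x f g fg; f_equal.
now extensionality y; extensionality p.
Qed.

Definition propP (delta : W) : Prop :=
  forall (n : nat) s s', chain delta n s s' ->
    exists s'' (epsilon : W),
      wo_lt W epsilon delta /\ steps s s'' /\ star (bar epsilon) s'' s'.

End Abc.

(* Main.v *)
From Stdlib Require Import Lia Classical IndefiniteDescription.
Require Import Defs.

(** By P_delta, the chain that starts a reduction from s to t at level delta may
    be replaced by finitely many beta steps followed by [bar]-reductions at one
    smaller level, and these are absorbed into the [bar]-reduction at level delta
    that follows. Hence s reduces by beta steps to a term which is
    [bar]-reducible to t and so has the same outermost shape. An induction on the
    position of the redex contracted in t then brings the statement down to
    compatibility of [red] with substitution, which is proved by well-founded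
    induction on the level and coinduction on the derivation. *)

Set Implicit Arguments.
Unset Strict Implicit.

(** * Guarded points of a labelled graph, by induction and by coinduction *)

Section Guarded.

Context (X : Type) (R : X -> bool -> X -> Prop).

Lemma guarded_intro x :
  (forall i y, R x i y -> guarded R y) -> guarded R x.
Proof.
intros H f i f0 Hf n.
assert (G : guarded R (f 1)) by (apply (H (i 0)); rewrite <- f0; apply Hf).
destruct (G (fun k => f (S k)) (fun k => i (S k)) eq_refl (fun k => Hf (S k)) n)
  as (m & nm & im).
exists (S m); split; [lia | exact im].
Qed.

Lemma guarded_next x i y : guarded R x -> R x i y -> guarded R y.
Proof.
intros G r f j f0 Hf n.
(* The path is prefixed with the step from [x] to [y]. A true label is sought from position [S n]
   on, so that it is not the added one and can be shifted back. *)
destruct (G (fun k => match k with 0 => x | S k => f k end)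
  (fun k => match k with 0 => i | S k => j k end) eq_refl) with (n := S n)
  as (m & nm & im).
- intros [|k]; [now rewrite f0 | apply Hf].
- destruct m as [|m]; [lia|].
  exists m; split; [lia | exact im].
Qed.

(** Otherwise choice builds an infinite path of non-accessible points whose labels are all false.
    Descent along such steps is the inductive half of the mixed arguments below. *)
Lemma guarded_acc x : guarded R x -> Acc (fun y z => R z false y) x.
Proof.
intros G; apply NNPP; intros nA.
set (N := {y | ~ Acc (fun y z => R z false y) y}).
assert (next : forall y : N, {z : N | R (proj1_sig y) false (proj1_sig z)}).
{ intros [y ny]; apply constructive_indefinite_description; simpl.
  apply NNPP; intros none; apply ny; constructor; intros z yz.
  apply NNPP; intros nz; apply none.
  now exists (exist _ z nz). }
set (f := fix f n := match n with
  0 => exist _ x nA | S k => proj1_sig (next (f k)) end : N).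
destruct (G (fun n => proj1_sig (f n)) (fun _ => false)) with (n := 0)
  as (m & _ & Hm); try easy.
intros n; exact (proj2_sig (next (f n))).
Qed.

Lemma guarded_ind (P : X -> Prop) :
  (forall x, guarded R x -> (forall y, R x false y -> P y) -> P x) ->
  forall x, guarded R x -> P x.
Proof.
intros H x G; induction (guarded_acc G) as [x _ IH].
apply H; [exact G|].
intros y xy; apply IH; [exact xy | exact (guarded_next G xy)].
Qed.

(* From [x], every path reaches, after finitely many steps, a [guarded] point or a
   step labelled [true] into [P]. *)
Inductive layer (P : X -> Prop) (x : X) : Prop :=
| layer_done : guarded R x -> layer P x
| layer_step :
    (forall i y, R x i y -> (i = true /\ P y) \/ layer P y) -> layer P x.

(** By [HP] a new layer starts at each true step into [P], so every point of a path carries a layer.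
    Layers being well-founded, the path meets a true label or a guarded point after finitely many
    steps. *)
Lemma guarded_coind (P : X -> Prop) :
  (forall x, P x -> layer P x) -> forall x, layer P x -> guarded R x.
Proof.
intros HP x Lx f i f0 Hf n.
assert (L : layer P (f n)).
{ induction n as [|n IH]; [now rewrite f0|].
  destruct IH as [G|IH].
  - exact (layer_done _ (guarded_next G (Hf n))).
  - destruct (IH _ _ (Hf n)) as [[_ p]|l]; auto. }
assert (K : forall y, layer P y -> forall k, f k = y ->
  exists m, k <= m /\ i m = true).
(* Structural recursion on the proof of [layer], whose recursive occurrence is nested under a
   disjunction. *)
{ fix IH 2; intros y [G|H] k E.
  - destruct (G (fun j => f (k + j)) (fun j => i (k + j))) with (n := 0)
      as (m & _ & im).
    + now rewrite PeanoNat.Nat.add_0_r.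
    + intros j; rewrite PeanoNat.Nat.add_succ_r; apply Hf.
    + exists (k + m); split; [lia | exact im].
  - subst y; destruct (H _ _ (Hf k)) as [[ik _]|l].
    + now exists k.
    + destruct (IH _ l (S k) eq_refl) as (m & km & im).
      exists m; split; [lia | exact im]. }
exact (K _ L n eq_refl).
Qed.

End Guarded.

(** * Substitution laws for infinite terms, up to [bisim] *)

Section Bisim.

(** The match forces a cofixpoint to reduce, which yields the computation rules of [ren] and
    [subst]. *)
Definition unfolded (t : term) : term :=
  match t with Var n => Var n | Lam u => Lam u | App u v => App u v end.

Lemma unfoldedE t : t = unfolded t.
Proof. now destruct t. Qed.

Lemma ren_var xi n : ren xi (Var n) = Var (xi n).
Proof. now rewrite (unfoldedE (ren _ _)). Qed.

Lemma ren_lam xi u : ren xi (Lam u) = Lam (ren (up_ren xi) u).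
Proof. now rewrite (unfoldedE (ren _ _)). Qed.

Lemma ren_app xi u v : ren xi (App u v) = App (ren xi u) (ren xi v).
Proof. now rewrite (unfoldedE (ren _ _)). Qed.

Lemma subst_var sigma n : subst sigma (Var n) = sigma n.
Proof. rewrite (unfoldedE (subst _ _)); simpl; now destruct (sigma n). Qed.

Lemma subst_lam sigma u : subst sigma (Lam u) = Lam (subst (up sigma) u).
Proof. now rewrite (unfoldedE (subst _ _)). Qed.

Lemma subst_app sigma u v :
  subst sigma (App u v) = App (subst sigma u) (subst sigma v).
Proof. now rewrite (unfoldedE (subst _ _)). Qed.

Lemma bisim_refl t : bisim t t.
Proof. revert t; cofix CIH; intros [n|u|u v]; constructor; apply CIH. Qed.

Lemma bisim_sym s t : bisim s t -> bisim t s.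
Proof.
revert s t; cofix CIH; intros s t [n|u u' H|u u' v v' H K];
  constructor; now apply CIH.
Qed.

Lemma bisim_trans s t u : bisim s t -> bisim t u -> bisim s u.
Proof.
revert s t u; cofix CIH; intros s t u [n|p p' H|p p' q q' H K] L;
  inversion L; subst; constructor; eauto.
Qed.

Lemma bisim_ren xi s t : bisim s t -> bisim (ren xi s) (ren xi t).
Proof.
revert xi s t; cofix CIH; intros xi s t [n|u u' H|u u' v v' H K].
- apply bisim_refl.
- rewrite !ren_lam; constructor; now apply CIH.
- rewrite !ren_app; constructor; now apply CIH.
Qed.

Lemma bisim_subst sigma tau s t :
  (forall n, bisim (sigma n) (tau n)) -> bisim s t ->
  bisim (subst sigma s) (subst tau t).
Proof.
revert sigma tau s t; cofix CIH; intros sigma tau s t Hn.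
intros [n|u u' H|u u' v v' H K].
- rewrite !subst_var; apply Hn.
- rewrite !subst_lam; constructor; apply CIH; [|exact H].
  intros [|n]; [constructor | apply bisim_ren, Hn].
- rewrite !subst_app; constructor; now apply CIH.
Qed.

Lemma subst_id sigma t :
  (forall n, bisim (sigma n) (Var n)) -> bisim (subst sigma t) t.
Proof.
revert sigma t; cofix CIH; intros sigma [n|u|u v] H.
- rewrite subst_var; apply H.
- rewrite subst_lam; constructor; apply CIH; intros [|n]; [constructor|].
  simpl; rewrite <- (ren_var S n); apply bisim_ren, H.
- rewrite subst_app; constructor; now apply CIH.
Qed.

(** In this and the following laws the resulting substitution or renaming is a variable constrained
    only pointwise, so that the coinduction hypothesis applies again under a binder, where all maps
    are lifted. *)
Lemma subst_ren sigma xi tau t :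
  (forall n, bisim (sigma (xi n)) (tau n)) ->
  bisim (subst sigma (ren xi t)) (subst tau t).
Proof.
revert sigma xi tau t; cofix CIH; intros sigma xi tau [n|u|u v] H.
- rewrite ren_var, !subst_var; apply H.
- rewrite ren_lam, !subst_lam; constructor; apply CIH.
  intros [|n]; [constructor | apply bisim_ren, H].
- rewrite ren_app, !subst_app; constructor; now apply CIH.
Qed.

Lemma ren_ren xi zeta theta t :
  (forall n, xi (zeta n) = theta n) -> bisim (ren xi (ren zeta t)) (ren theta t).
Proof.
revert xi zeta theta t; cofix CIH; intros xi zeta theta [n|u|u v] H.
- rewrite !ren_var, H; constructor.
- rewrite !ren_lam; constructor; apply CIH.
  intros [|n]; [reflexivity | simpl; now rewrite H].
- rewrite !ren_app; constructor; now apply CIH.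
Qed.

Lemma subst_vars sigma xi t :
  (forall n, bisim (sigma n) (Var (xi n))) -> bisim (subst sigma t) (ren xi t).
Proof.
revert sigma xi t; cofix CIH; intros sigma xi [n|u|u v] H.
- rewrite subst_var, ren_var; apply H.
- rewrite subst_lam, ren_lam; constructor; apply CIH; intros [|n]; [constructor|].
  simpl; rewrite <- (ren_var S); apply bisim_ren, H.
- rewrite subst_app, ren_app; constructor; now apply CIH.
Qed.

Lemma ren_subst xi sigma tau t :
  (forall n, bisim (ren xi (sigma n)) (tau n)) ->
  bisim (ren xi (subst sigma t)) (subst tau t).
Proof.
revert xi sigma tau t; cofix CIH; intros xi sigma tau [n|u|u v] H.
- rewrite !subst_var; apply H.
- rewrite !subst_lam, ren_lam; constructor; apply CIH; intros [|n]; simpl.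
  + rewrite ren_var; constructor.
  (* Both [ren (up_ren xi)] after [ren S] and [ren S] after [ren xi] rename along
     [fun k => S (xi k)]. *)
  + apply bisim_trans with (ren (fun k => S (xi k)) (sigma n)).
    * now apply ren_ren.
    * apply bisim_trans with (ren S (ren xi (sigma n))).
      -- now apply bisim_sym, ren_ren.
      -- apply bisim_ren, H.
- rewrite !subst_app, ren_app; constructor; now apply CIH.
Qed.

Lemma subst_subst sigma tau rho t :
  (forall n, bisim (subst tau (sigma n)) (rho n)) ->
  bisim (subst tau (subst sigma t)) (subst rho t).
Proof.
revert sigma tau rho t; cofix CIH; intros sigma tau rho [n|u|u v] H.
- rewrite !subst_var; apply H.
- rewrite !subst_lam; constructor; apply CIH; intros [|n]; simpl.
  + rewrite subst_var; constructor.
  + apply bisim_trans with (subst (fun k => ren S (tau k)) (sigma n)).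
    * apply subst_ren; intros k; apply bisim_refl.
    * apply bisim_trans with (ren S (subst tau (sigma n))).
      -- apply bisim_sym, ren_subst; intros k; apply bisim_refl.
      -- apply bisim_ren, H.
- rewrite !subst_app; constructor; now apply CIH.
Qed.

(** Both sides amount to the simultaneous substitution sending 0 to [subst sigma t] and [S k] to
    [sigma k]. *)
Lemma subst_subst0 sigma s t :
  bisim (subst sigma (subst0 s t)) (subst0 (subst (up sigma) s) (subst sigma t)).
Proof.
unfold subst0.
apply bisim_trans with
  (subst (fun n => match n with 0 => subst sigma t | S k => sigma k end) s).
- apply subst_subst; intros [|n]; [apply bisim_refl|].
  rewrite subst_var; apply bisim_refl.
- apply bisim_sym, subst_subst; intros [|n]; simpl.
  + rewrite subst_var; apply bisim_refl.
  + apply bisim_trans with (subst Var (sigma n)).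
    * apply subst_ren; intros k; apply bisim_refl.
    * apply subst_id; intros k; apply bisim_refl.
Qed.

Lemma beta_subst sigma s t :
  beta s t -> exists t', beta (subst sigma s) t' /\ bisim t' (subst sigma t).
Proof.
intros B; revert sigma; induction B; intros sigma.
- rewrite subst_app, subst_lam; eexists; split; [constructor|].
  apply bisim_sym, subst_subst0.
- destruct (IHB (up sigma)) as (t' & B' & E).
  rewrite !subst_lam; exists (Lam t'); split; now constructor.
- destruct (IHB sigma) as (t' & B' & E).
  rewrite !subst_app; exists (App t' (subst sigma v)).
  split; constructor; auto using bisim_refl.
- destruct (IHB sigma) as (t' & B' & E).
  rewrite !subst_app; exists (App (subst sigma u) t').
  split; constructor; auto using bisim_refl.
Qed.

End Bisim.

(** * Guardedness of renamed and substituted terms; finite beta-reduction *)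

Section Terms.

Context (a b c : bool).

Implicit Types s t u v : abcterm a b c.

Lemma subterm_inv (t : term) i (w : term) :
  subterm a b c t i w ->
  match t with
  | Var _ => False
  | Lam u => i = a /\ w = u
  | App u v => (i = b /\ w = u) \/ (i = c /\ w = v)
  end.
Proof. intros []; auto. Qed.

(** A path in [h x u] follows a path in [u] with the same labels until it possibly enters a term
    already known to be guarded. The parameter [x] may change along the way, as renamings and
    substitutions do under a binder. *)
Lemma guarded_image (A : Type) (h : A -> term -> term) :
  (forall x (u : term) i w, subterm a b c (h x u) i w ->
    guarded (subterm a b c) w \/
    exists y (u' : term), w = h y u' /\ subterm a b c u i u') ->
  forall x (u : term),
    guarded (subterm a b c) u -> guarded (subterm a b c) (h x u).
Proof.
intros Hh.
set (P := fun w => exists x (u : term), guarded (subterm a b c) u /\ w = h x u).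
assert (L : forall u : term, guarded (subterm a b c) u ->
  forall x, layer (subterm a b c) P (h x u)).
{ refine (guarded_ind _); intros u G IH x.
  apply layer_step; intros i w H.
  destruct (Hh _ _ _ _ H) as [Gw|(y & u' & -> & K)].
  - right; now apply layer_done.
  - destruct i.
    + left; split; [reflexivity|].
      exists y, u'; split; [exact (guarded_next G K) | reflexivity].
    + right; now apply IH. }
intros x u G; apply (guarded_coind (P := P)); [|now apply L].
intros w (y & v & Gv & ->); now apply L.
Qed.

Lemma guarded_var n : guarded (subterm a b c) (Var n).
Proof. apply guarded_intro; intros i y H; inversion H. Qed.

Lemma guarded_ren xi (t : term) :
  guarded (subterm a b c) t -> guarded (subterm a b c) (ren xi t).
Proof.
apply (guarded_image (h := ren)); clear xi t; intros xi u i w H; right.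
destruct u.
- rewrite ren_var in H; inversion H.
- rewrite ren_lam in H; inversion H; subst; eexists _, _; split; constructor.
- rewrite ren_app in H; inversion H; subst; eexists _, _; split; constructor.
Qed.

Lemma guarded_up (sigma : nat -> term) :
  (forall n, guarded (subterm a b c) (sigma n)) ->
  forall n, guarded (subterm a b c) (up sigma n).
Proof. intros H [|n]; [apply guarded_var | apply guarded_ren, H]. Qed.

Lemma guarded_subst (sigma : nat -> term) (t : term) :
  (forall n, guarded (subterm a b c) (sigma n)) ->
  guarded (subterm a b c) t -> guarded (subterm a b c) (subst sigma t).
Proof.
intros Hs.
(* The parameters are the substitutions with guarded values, a condition that [guarded_up] preserves
   under binders. *)
apply (guarded_image (A := {tau | forall n, guarded (subterm a b c) (tau n)})
  (h := fun tau => subst (proj1_sig tau))) with (x := exist _ sigma Hs).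
clear sigma t Hs; intros [sigma Hs] u i w H; simpl in *.
destruct u as [n|u|u v].
- left; rewrite subst_var in H; exact (guarded_next (Hs n) H).
- rewrite subst_lam in H; apply subterm_inv in H as [-> ->]; right.
  exists (exist _ _ (guarded_up Hs)); eexists; split; constructor.
- rewrite subst_app in H; right; exists (exist _ _ Hs).
  apply subterm_inv in H as [[-> ->]|[-> ->]]; eexists; split; constructor.
Qed.

Lemma guarded_lam u : guarded (subterm a b c) (Lam u).
Proof.
apply guarded_intro; intros i y H; inversion H; subst; apply tm_guarded.
Qed.

Lemma guarded_app u v : guarded (subterm a b c) (App u v).
Proof.
apply guarded_intro; intros i y H; inversion H; subst; apply tm_guarded.
Qed.

Definition var_abc n : abcterm a b c := AbcTerm (@guarded_var n).
Definition lam_abc u : abcterm a b c := AbcTerm (@guarded_lam u).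
Definition app_abc u v : abcterm a b c := AbcTerm (@guarded_app u v).

Definition subst_abc (sigma : nat -> abcterm a b c) u : abcterm a b c :=
  AbcTerm (@guarded_subst sigma u (fun n => tm_guarded (sigma n)) (tm_guarded u)).

Definition ren_abc xi u : abcterm a b c :=
  AbcTerm (@guarded_ren xi u (tm_guarded u)).

Definition up_abc (sigma : nat -> abcterm a b c) (n : nat) : abcterm a b c :=
  match n with 0 => var_abc 0 | S k => ren_abc S (sigma k) end.

Lemma bisim_var_inv s n : bisim s (Var n) -> tm s = Var n.
Proof. intros H; now inversion H. Qed.

Lemma lam_inv s (u : term) : tm s = Lam u -> exists u', tm u' = u.
Proof.
intros E.
assert (G : guarded (subterm a b c) u).
{ apply (guarded_next (tm_guarded s) (i := a)); rewrite E; constructor. }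
now exists (AbcTerm G).
Qed.

Lemma app_inv s (u v : term) :
  tm s = App u v -> exists u' v', tm u' = u /\ tm v' = v.
Proof.
intros E.
assert (G : guarded (subterm a b c) u).
{ apply (guarded_next (tm_guarded s) (i := b)); rewrite E; constructor. }
assert (K : guarded (subterm a b c) v).
{ apply (guarded_next (tm_guarded s) (i := c)); rewrite E; constructor. }
now exists (AbcTerm G), (AbcTerm K).
Qed.

Lemma bisim_lam_inv s (u : term) :
  bisim s (Lam u) -> exists u', tm s = Lam u' /\ bisim u' u.
Proof.
intros H; inversion H as [|w w' K E|]; subst.
destruct (lam_inv (eq_sym E)) as (u' & <-); now exists u'.
Qed.

Lemma bisim_app_inv s (u v : term) :
  bisim s (App u v) ->
  exists u' v', tm s = App u' v' /\ bisim u' u /\ bisim v' v.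
Proof.
intros H; inversion H as [| |w w' x x' K L E]; subst.
destruct (app_inv (eq_sym E)) as (u' & v' & <- & <-); now exists u', v'.
Qed.

(** The two lifted substitutions agree pointwise by computation, but are not convertible as
    functions. *)
Lemma subst_up_abc sigma (t : term) :
  bisim (subst (up (fun n => tm (sigma n))) t)
    (subst (fun n => tm (up_abc sigma n)) t).
Proof. apply bisim_subst; [intros [|n]|]; apply bisim_refl. Qed.

Lemma step_bisim s s' t t' : bisim s s' -> step s' t' -> bisim t' t -> step s t.
Proof.
intros E (s0 & t0 & Es & B & Et) F; exists s0, t0.
eauto using bisim_trans.
Qed.

Lemma star_bisim_l (R : abcterm a b c -> abcterm a b c -> Prop) s s' t :
  (forall u u' v, bisim u u' -> R u' v -> R u v) ->
  bisim s s' -> star R s' t -> star R s t.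
Proof.
intros HR E H; inversion H; subst.
- apply star_refl; eauto using bisim_trans.
- eapply star_step; eauto.
Qed.

Lemma steps_bisim_l s s' t : bisim s s' -> steps s' t -> steps s t.
Proof.
apply star_bisim_l; intros u u' v E H; eauto using step_bisim, bisim_refl.
Qed.

Lemma steps_trans s t u : steps s t -> steps t u -> steps s u.
Proof.
intros H K; induction H as [s t E|s s' t H _ IH].
- exact (steps_bisim_l E K).
- eapply star_step; [exact H | exact (IH K)].
Qed.

Lemma steps_refl s : steps s s.
Proof. apply star_refl, bisim_refl. Qed.

Lemma steps_step s t : step s t -> steps s t.
Proof. intros H; eapply star_step; [exact H | apply steps_refl]. Qed.

Lemma steps_map (h : abcterm a b c -> abcterm a b c) :
  (forall s t, bisim s t -> bisim (h s) (h t)) ->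
  (forall s t, step s t -> step (h s) (h t)) ->
  forall s t, steps s t -> steps (h s) (h t).
Proof.
intros Hb Hs s t H; induction H as [s t E|s s' t H _ IH].
- now apply star_refl, Hb.
- eapply star_step; [apply Hs, H | exact IH].
Qed.

Lemma steps_lam u u' : steps u u' -> steps (lam_abc u) (lam_abc u').
Proof.
apply steps_map; simpl; intros s t H.
- now constructor.
- destruct H as (s0 & t0 & E & B & F).
  exists (Lam s0), (Lam t0); repeat split; now constructor.
Qed.

Lemma steps_app u u' v v' :
  steps u u' -> steps v v' -> steps (app_abc u v) (app_abc u' v').
Proof.
intros H K; apply steps_trans with (app_abc u' v).
- revert H; apply (steps_map (h := fun w => app_abc w v)); simpl; intros s t L.
  + constructor; auto using bisim_refl.
  + destruct L as (s0 & t0 & E & B & F).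
    exists (App s0 v), (App t0 v); repeat split; constructor;
      auto using bisim_refl.
- revert K; apply steps_map; simpl; intros s t L.
  + constructor; auto using bisim_refl.
  + destruct L as (s0 & t0 & E & B & F).
    exists (App u' s0), (App u' t0); repeat split; constructor;
      auto using bisim_refl.
Qed.

Lemma steps_subst sigma s t :
  steps s t -> steps (subst_abc sigma s) (subst_abc sigma t).
Proof.
apply steps_map; simpl; clear s t; intros s t H.
- apply bisim_subst; auto using bisim_refl.
- destruct H as (s0 & t0 & E & B & F).
  destruct (beta_subst (fun n => tm (sigma n)) B) as (t' & B' & E').
  exists (subst (fun n => tm (sigma n)) s0), t'; repeat split.
  + apply bisim_subst; auto using bisim_refl.
  + exact B'.
  + eapply bisim_trans; [exact E'|].
    apply bisim_subst; auto using bisim_refl.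
Qed.

End Terms.

(** * Derivations at one level, relative to given relations at the smaller levels *)

Section Derivations.

Context (a b c : bool) (W : wellorder) (gamma : W).
Context (lower : forall delta : W,
  wo_lt W delta gamma -> abcterm a b c -> abcterm a b c -> Prop).

Implicit Types s t u v : abcterm a b c.

Notation chain_lower := (chain_of W gamma lower).
Notation red_lower := (red_of W gamma lower).
Notation bar_lower := (bar_of W gamma lower).
Notation is_premiss := (@premiss a b c W gamma lower).

(** Inverting [premiss] directly would produce equalities of dependent pairs; a description computed
    by matching on the derivation avoids them. *)
Definition premiss_spec (x : deriv W gamma lower) (i : bool)
    (y : deriv W gamma lower) : Prop :=
  match x with
  | RedDeriv (split _ d) => i = false /\ y = BarDeriv d
  | BarDeriv (lift_var _ _ _ _ _ _ _) => False
  | BarDeriv (lift_lam _ _ _ _ d) => i = a /\ y = RedDeriv d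
  | BarDeriv (lift_app _ _ _ _ d e) =>
      (i = b /\ y = RedDeriv d) \/ (i = c /\ y = RedDeriv e)
  end.

Lemma premissE x i y : is_premiss x i y <-> premiss_spec x i y.
Proof.
split; [intros []; simpl; auto|].
destruct x as [s t [m s0 s' t0 h d]
  |s t [s0 t0 n es et|s0 t0 u u' es et d|s0 t0 u u' v v' es et d e]];
  simpl.
- intros [-> ->]; constructor.
- intros [].
- intros [-> ->]; constructor.
- intros [[-> ->]|[-> ->]]; constructor.
Qed.

(* One layer of [bar_deriv]; [i] in [K i] is the label of the premiss. *)
Inductive lifted (K : bool -> abcterm a b c -> abcterm a b c -> Prop) s t :
  Prop :=
| lifted_var n : tm s = Var n -> tm t = Var n -> lifted K s t
| lifted_lam u u' : tm s = Lam u -> tm t = Lam u' -> K a u u' -> lifted K s t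
| lifted_app u u' v v' :
    tm s = App u v -> tm t = App u' v' -> K b u u' -> K c v v' -> lifted K s t.

(** Guardedness ignores a finite initial part of a branch, so derivations can be taken apart and
    reassembled one rule at a time. *)
Lemma red_ofE s t :
  red_lower s t <-> exists m s', chain_lower m s s' /\ bar_lower s' t.
Proof.
split.
- intros [d G]; destruct d as [m s s' t h d].
  exists m, s'; split; [exact h|].
  exists d; apply (guarded_next G (i := false)); constructor.
- intros (m & s' & h & d & G).
  exists (split h d); apply guarded_intro.
  intros i y H; apply premissE in H as [-> ->]; exact G.
Qed.

Lemma bar_ofE s t : bar_lower s t <-> lifted (fun _ => red_lower) s t.
Proof.
split.
- intros [d G].
  destruct d as [s t n es et|s t u u' es et d|s t u u' v v' es et d e].
  + exact (lifted_var _ es et).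
  + apply (lifted_lam es et); exists d.
    apply (guarded_next G (i := a)); constructor.
  + apply (lifted_app es et).
    * exists d; apply (guarded_next G (i := b)); constructor.
    * exists e; apply (guarded_next G (i := c)); constructor.
- intros [n es et|u u' es et [d G]|u u' v v' es et [d G] [e G']].
  + exists (lift_var W gamma lower s t es et); apply guarded_intro.
    intros i y H; apply premissE in H as [].
  + exists (lift_lam s t es et d); apply guarded_intro.
    intros i y H; apply premissE in H as [-> ->]; exact G.
  + exists (lift_app s t es et d e); apply guarded_intro.
    intros i y H; apply premissE in H as [[-> ->]|[-> ->]]; assumption.
Qed.

Lemma red_of_ind (P : abcterm a b c -> abcterm a b c -> Prop) :
  (forall m s s' t, chain_lower m s s' ->
    lifted (fun i u u' => red_lower u u' /\ (i = false -> P u u')) s' t ->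
    P s t) ->
  forall s t, red_lower s t -> P s t.
Proof.
intros HP.
(* The premiss of the split rule is labelled false, so the induction passes through [bar]
   derivations; there [PP] collects what [HP] asks for. *)
set (PP := fun x : deriv W gamma lower => match x with
  | @RedDeriv _ _ _ _ _ _ s t _ => P s t
  | @BarDeriv _ _ _ _ _ _ s t _ =>
      lifted (fun i u u' => red_lower u u' /\ (i = false -> P u u')) s t
  end).
assert (H : forall x, guarded is_premiss x -> PP x).
{ apply guarded_ind; intros x G IH.
  assert (sub : forall i s t (d : red_deriv W gamma lower s t),
    is_premiss x i (RedDeriv d) ->
    red_lower s t /\ (i = false -> P s t)).
  { intros i s t d H; split.
    - exists d; exact (guarded_next G H).
    - intros ->; exact (IH _ H). }
  destruct x as [s t [m s0 s' t0 h d]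
  |s t [s0 t0 n es et|s0 t0 u u' es et d|s0 t0 u u' v v' es et d e]];
    simpl.
  - apply (HP m _ s' _ h), (IH (BarDeriv d)); constructor.
  - exact (lifted_var _ es et).
  - apply (lifted_lam es et), (sub _ _ _ d); constructor.
  - apply (lifted_app es et); eapply sub; constructor. }
intros s t [d G]; exact (H _ G).
Qed.

(** * Guarded derivations built by mixed induction and coinduction *)

Section Coinduction.

Context (P : abcterm a b c -> abcterm a b c -> Prop).

(* In [Type], so that derivations can be computed from it by corecursion. *)
Inductive red_tree : abcterm a b c -> abcterm a b c -> Type :=
| tree_done s t : red_lower s t -> red_tree s t
| tree_var m s s' t n :
    chain_lower m s s' -> tm s' = Var n -> tm t = Var n -> red_tree s t
| tree_lam m s s' t u u' :
    chain_lower m s s' -> tm s' = Lam u -> tm t = Lam u' ->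
    red_edge a u u' -> red_tree s t
| tree_app m s s' t u u' v v' :
    chain_lower m s s' -> tm s' = App u v -> tm t = App u' v' ->
    red_edge b u u' -> red_edge c v v' -> red_tree s t
with red_edge : bool -> abcterm a b c -> abcterm a b c -> Type :=
| edge_co u u' : P u u' -> red_edge true u u'
| edge_tree i u u' : red_tree u u' -> red_edge i u u'.

Scheme red_tree_mut := Induction for red_tree Sort Prop
with red_edge_mut := Induction for red_edge Sort Prop.

(** Truncation to [Prop] allows layers to be built by proofs; [red_of_coind] recovers by choice the
    trees that drive the corecursion. *)
Definition red_layer s t : Prop := inhabited (red_tree s t).

Lemma red_layer_done s t : red_lower s t -> red_layer s t.
Proof. intros H; constructor; exact (tree_done H). Qed.

Lemma red_layer_step m s s' t :
  chain_lower m s s' ->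
  lifted (fun i u u' => (i = true /\ P u u') \/ red_layer u u') s' t ->
  red_layer s t.
Proof.
assert (edge : forall i u u',
  (i = true /\ P u u') \/ red_layer u u' -> inhabited (red_edge i u u')).
{ intros i u u' [[-> p]|[r]]; constructor; [now constructor | now apply edge_tree]. }
intros h [n es et|u u' es et k|u u' v v' es et k l].
- constructor; exact (tree_var h es et).
- destruct (edge _ _ _ k) as [k']; constructor; exact (tree_lam h es et k').
- destruct (edge _ _ _ k) as [k'], (edge _ _ _ l) as [l'].
  constructor; exact (tree_app h es et k' l').
Qed.

Context (unfold_tree : forall s t, P s t -> red_tree s t).

Definition edge_red_tree i u u' (k : red_edge i u u') : red_tree u u' :=
  match k with
  | edge_co p => unfold_tree p
  | edge_tree _ r => r
  end.

CoFixpoint tree_deriv s t (r : red_tree s t) : red_deriv W gamma lower s t :=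
  match r with
  | tree_done H => proj1_sig (constructive_indefinite_description _ H)
  | tree_var h es et => split h (lift_var W gamma lower _ _ es et)
  | tree_lam h es et k =>
      split h (lift_lam _ _ es et (tree_deriv (edge_red_tree k)))
  | tree_app h es et k l =>
      split h (lift_app _ _ es et (tree_deriv (edge_red_tree k))
        (tree_deriv (edge_red_tree l)))
  end.

(** Mutual induction on trees and edges gives a layer for each tree: an edge [edge_co] is labelled
    true and leads to another computed derivation, and any other edge leads to a smaller tree. *)
Lemma tree_deriv_guarded s t (r : red_tree s t) :
  guarded is_premiss (RedDeriv (tree_deriv r)).
Proof.
set (PP := fun x => exists s t (q : red_tree s t), x = RedDeriv (tree_deriv q)).
assert (L : forall s t (q : red_tree s t),
  layer is_premiss PP (RedDeriv (tree_deriv q))).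
{ clear s t r.
  refine (red_tree_mut
    (P := fun s t q => layer is_premiss PP (RedDeriv (tree_deriv q)))
    (P0 := fun i u u' k =>
      (i = true /\ PP (RedDeriv (tree_deriv (edge_red_tree k)))) \/
      layer is_premiss PP (RedDeriv (tree_deriv (edge_red_tree k)))) _ _ _ _ _ _).
  - intros s t H; apply layer_done.
    (* The cofixpoint does not by itself reduce to the chosen derivation, but the match in
       [premiss_spec] forces it, so both have the same premisses. *)
    apply guarded_intro; intros i y Hy.
    pose proof (proj2_sig (constructive_indefinite_description _ H)) as G.
    apply (guarded_next G (i := i)), premissE.
    apply premissE in Hy; exact Hy.
  - intros m s s' t n h es et; apply layer_step; intros i x H.
    apply premissE in H as [-> ->]; right.
    apply layer_done, guarded_intro; intros i y H; now apply premissE in H.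
  - intros m s s' t u u' h es et k Hk; apply layer_step; intros i x H.
    apply premissE in H as [-> ->]; right; apply layer_step; intros i x H.
    apply premissE in H as [-> ->]; exact Hk.
  - intros m s s' t u u' v v' h es et k Hk l Hl; apply layer_step; intros i x H.
    apply premissE in H as [-> ->]; right; apply layer_step; intros i x H.
    apply premissE in H as [[-> ->]|[-> ->]]; assumption.
  - intros u u' p; left; split; [reflexivity|]; now eexists _, _, _.
  - intros i u u' q Hq; now right. }
apply (guarded_coind (P := PP)); [|apply L].
intros x (s0 & t0 & q & ->); apply L.
Qed.

End Coinduction.

Lemma red_of_coind (P : abcterm a b c -> abcterm a b c -> Prop) :
  (forall s t, P s t -> red_layer P s t) ->
  forall s t, red_layer P s t -> red_lower s t.
Proof.
intros HP s t [r].
assert (f : forall s t, P s t -> red_tree P s t).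
{ intros u v p.
  refine (proj1_sig (constructive_indefinite_description (fun _ => True) _)).
  destruct (HP _ _ p) as [q]; now exists q. }
exists (tree_deriv f r); apply tree_deriv_guarded.
Qed.

End Derivations.

(** * Chains, [red] and [bar] across levels, and their invariance under [bisim] *)

Section Levels.

Context (a b c : bool) (W : wellorder).

Implicit Types s t u v : abcterm a b c.
Implicit Types delta epsilon : W.

Notation layered delta :=
  (@red_layer a b c W delta (fun epsilon _ => bar W epsilon)).

Lemma redE delta s t :
  red W delta s t <-> exists m s', chain W delta m s s' /\ bar W delta s' t.
Proof. rewrite bar_unfold; apply red_ofE. Qed.

Lemma barE delta s t : bar W delta s t <-> lifted (fun _ => red W delta) s t.
Proof. rewrite bar_unfold; apply bar_ofE. Qed.

Lemma chain_bar delta epsilon m s s1 t1 t :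
  wo_lt W epsilon delta -> steps s s1 -> bar W epsilon s1 t1 ->
  chain W delta m t1 t -> chain W delta (S m) s t.
Proof. intros e H B L; exact (chain_cons _ e H B L). Qed.

Lemma chain_steps_l delta m s s' t :
  steps s s' -> chain W delta m s' t -> chain W delta m s t.
Proof.
intros H K; destruct K as [s' t K|m s' s1 t1 t epsilon h K B L].
- apply chain_nil; exact (steps_trans H K).
- exact (chain_bar h (steps_trans H K) B L).
Qed.

Lemma chain_trans delta m n s t u :
  chain W delta m s t -> chain W delta n t u -> chain W delta (m + n) s u.
Proof.
intros H K; induction H as [s t H|m s s1 t1 t epsilon h H B L IH]; simpl.
- exact (chain_steps_l H K).
- exact (chain_bar h H B (IH K)).
Qed.

Lemma chain_mono delta epsilon m s t :
  wo_lt W epsilon delta -> chain W epsilon m s t -> chain W delta m s t.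
Proof.
intros e H; induction H as [s t H|m s s1 t1 t zeta h H B L IH].
- now apply chain_nil.
- apply (chain_bar (wo_trans _ _ _ _ h e) H B IH).
Qed.

Lemma chain_refl delta s : chain W delta 0 s s.
Proof. apply chain_nil, steps_refl. Qed.

Lemma red_bar delta s t : bar W delta s t -> red W delta s t.
Proof. intros H; apply redE; exists 0, s; split; [apply chain_refl | exact H]. Qed.

Lemma red_chain_l delta m s s' t :
  chain W delta m s s' -> red W delta s' t -> red W delta s t.
Proof.
intros H K; apply redE in K as (n & s1 & K & B); apply redE.
exists (m + n), s1; split; [exact (chain_trans H K) | exact B].
Qed.

Lemma red_steps_l delta s s' t :
  steps s s' -> red W delta s' t -> red W delta s t.
Proof. intros H; apply (red_chain_l (m := 0)), chain_nil, H. Qed.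

Lemma red_bisim_l delta s s' t :
  bisim s s' -> red W delta s' t -> red W delta s t.
Proof. intros H; apply red_steps_l, star_refl, H. Qed.

Lemma bar_bisim_l delta s s' t :
  bisim s s' -> bar W delta s' t -> bar W delta s t.
Proof.
intros E H; apply barE in H; apply barE.
destruct H as [n es et|u u' es et H|u u' v v' es et H K]; rewrite es in E.
- exact (lifted_var _ (bisim_var_inv E) et).
- destruct (bisim_lam_inv E) as (w & es' & F).
  exact (lifted_lam es' et (red_bisim_l F H)).
- destruct (bisim_app_inv E) as (w & x & es' & F & G).
  exact (lifted_app es' et (red_bisim_l F H) (red_bisim_l G K)).
Qed.

(** The derivation copies the tree of [s], with trivial chains, and its branches are guarded because
    those of [s] are: induction at the subterms labelled false, coinduction at those labelled
    true. *)
Lemma red_bisim delta s t : bisim s t -> red W delta s t.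
Proof.
set (P := fun s t => bisim s t).
set (L := layered delta P).
assert (H : forall x : term, guarded (subterm a b c) x ->
  forall s t, tm s = x -> bisim s t -> L s t).
{ refine (guarded_ind _); intros x _ IH s' t' Ex E.
  assert (IH' : forall i u u', subterm a b c s' i u -> bisim u u' ->
    (i = true /\ P u u') \/ L u u').
  { intros [] u u' Hs F; [now left | right].
    rewrite Ex in Hs; exact (IH _ Hs _ _ eq_refl F). }
  apply (red_layer_step (chain_refl delta s')).
  destruct (tm s') as [n|u|u v] eqn:es.
  - exact (lifted_var _ es (bisim_var_inv (bisim_sym E))).
  - destruct (lam_inv es) as (u1 & <-).
    destruct (bisim_lam_inv (bisim_sym E)) as (u2 & et & F).
    apply (lifted_lam es et), IH'; [constructor | exact (bisim_sym F)].
  - destruct (app_inv es) as (u1 & v1 & <- & <-).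
    destruct (bisim_app_inv (bisim_sym E)) as (u2 & v2 & et & F & G).
    apply (lifted_app es et); apply IH'; (constructor || now apply bisim_sym). }
intros E; apply (red_of_coind (P := P)).
- intros u v F; exact (H _ (tm_guarded u) _ _ eq_refl F).
- exact (H _ (tm_guarded s) _ _ eq_refl E).
Qed.

Lemma bar_bisim delta s t : bisim s t -> bar W delta s t.
Proof.
intros E; apply barE.
destruct (tm s) as [n|u|u v] eqn:es.
- exact (lifted_var _ es (bisim_var_inv (bisim_sym E))).
- destruct (lam_inv es) as (u1 & <-).
  destruct (bisim_lam_inv (bisim_sym E)) as (u2 & et & F).
  exact (lifted_lam es et (red_bisim _ (bisim_sym F))).
- destruct (app_inv es) as (u1 & v1 & <- & <-).
  destruct (bisim_app_inv (bisim_sym E)) as (u2 & v2 & et & F & G).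
  exact (lifted_app es et (red_bisim _ (bisim_sym F)) (red_bisim _ (bisim_sym G))).
Qed.

(** * Compatibility of [red] with substitution *)

(* Used for [R = red] and, to treat the chains, where both sides receive the same
   substitution, for [R = bisim] at the smaller levels. *)
Record substitutive delta (R : abcterm a b c -> abcterm a b c -> Prop) :
  Prop := {
  substitutive_red s t : R s t -> red W delta s t;
  substitutive_bisim s s' t t' : bisim s s' -> R s' t' -> bisim t' t -> R s t;
  substitutive_ren s t : R s t -> R (ren_abc S s) (ren_abc S t);
  substitutive_var n : R (var_abc a b c n) (var_abc a b c n) }.

Lemma substitutive_up delta R (sigma tau : nat -> abcterm a b c) :
  substitutive delta R -> (forall n, R (sigma n) (tau n)) ->
  forall n, R (up_abc sigma n) (up_abc tau n).
Proof.
intros HR H [|n]; [apply (substitutive_var HR) | apply (substitutive_ren HR), H].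
Qed.

Lemma bisim_substitutive delta : substitutive delta (fun s t => bisim s t).
Proof.
split.
- apply red_bisim.
- eauto using bisim_trans.
- intros s t; apply bisim_ren.
- intros n; apply bisim_refl.
Qed.

(** Images are taken up to [bisim] because, under a binder, the bodies match a substitution by
    [up_abc] only up to [bisim]. *)
Inductive subst_image (R : abcterm a b c -> abcterm a b c -> Prop) u u' s t :
  Prop :=
| SubstImage (sigma tau : nat -> abcterm a b c) :
    (forall n, R (sigma n) (tau n)) ->
    bisim s (subst_abc sigma u) -> bisim t (subst_abc tau u') ->
    subst_image R u u' s t.

(** At a variable the rule is replaced by the [R]-related pair of substituted terms; elsewhere it is
    kept, with images as premisses. [K] and [K'] are left open to serve both the induction on levels
    and the coinduction on derivations. *)
Lemma subst_image_lifted delta R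
    (K K' : bool -> abcterm a b c -> abcterm a b c -> Prop) u u' sigma tau t :
  substitutive delta R -> (forall n, R (sigma n) (tau n)) ->
  bisim t (subst_abc tau u') ->
  lifted K u u' ->
  (forall i v v' w w', K i v v' -> subst_image R v v' w w' -> K' i w w') ->
  R (subst_abc sigma u) t \/ lifted K' (subst_abc sigma u) t.
Proof.
intros HR HRs E L HK.
assert (HRu := substitutive_up HR HRs).
assert (up_img : forall v v' w w' : abcterm a b c,
  tm w = subst (up (fun n => tm (sigma n))) v ->
  bisim w' (subst (up (fun n => tm (tau n))) v') -> subst_image R v v' w w').
{ intros v v' w w' Ew Ew'; exists (up_abc sigma) (up_abc tau); auto.
  - rewrite Ew; apply subst_up_abc.
  - eapply bisim_trans; [exact Ew' | apply subst_up_abc]. }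
destruct L as [n es et|v v' es et Kv|v v' w w' es et Kv Kw]; simpl in E.
- left; apply (substitutive_bisim HR) with (sigma n) (tau n); [| apply HRs |].
  + simpl; rewrite es, subst_var; apply bisim_refl.
  + apply bisim_sym; rewrite et, subst_var in E; exact E.
- right; rewrite et, subst_lam in E.
  destruct (bisim_lam_inv E) as (x' & et' & F).
  assert (es' : tm (subst_abc sigma u) =
    Lam (subst (up (fun n => tm (sigma n))) v)).
  { simpl; rewrite es; apply subst_lam. }
  destruct (lam_inv es') as (x & Ex); rewrite <- Ex in es'.
  apply (lifted_lam es' et'), (HK _ _ _ _ _ Kv); auto.
- right; rewrite et, subst_app in E.
  destruct (bisim_app_inv E) as (x' & y' & et' & F & G).
  assert (es' : tm (subst_abc sigma u) =
    App (subst_abc sigma v) (subst_abc sigma w)).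
  { simpl; rewrite es; apply subst_app. }
  apply (lifted_app es' et').
  + apply (HK _ _ _ _ _ Kv); exists sigma tau; auto using bisim_refl.
  + apply (HK _ _ _ _ _ Kw); exists sigma tau; auto using bisim_refl.
Qed.

Lemma red_subst delta R u u' s t :
  substitutive delta R -> red W delta u u' -> subst_image R u u' s t ->
  red W delta s t.
Proof.
revert R u u' s t; induction (wo_wf W delta) as [delta _ IH].
intros R u u' s t HR.
(* The links of a chain lie at smaller levels and receive [sigma] on both sides, so the induction
   hypothesis is used there with [bisim] for [R]. *)
assert (bar_subst : forall epsilon, wo_lt W epsilon delta -> forall sigma v v',
  bar W epsilon v v' -> bar W epsilon (subst_abc sigma v) (subst_abc sigma v')).
{ intros epsilon e sigma v v' B; apply barE in B.
  assert (HB := bisim_substitutive epsilon).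
  destruct (subst_image_lifted (sigma := sigma) (tau := sigma)
    (K' := fun _ => red W epsilon) HB
    (fun n => bisim_refl _) (bisim_refl _) B) as [E|L].
  - intros i w w' x x' Hr Hi; exact (IH epsilon e _ _ _ _ _ HB Hr Hi).
  - now apply bar_bisim.
  - now apply barE. }
assert (chain_subst : forall m sigma v v',
  chain W delta m v v' ->
  chain W delta m (subst_abc sigma v) (subst_abc sigma v')).
{ intros m sigma v v' H.
  induction H as [v v' H|m v v1 w1 v' epsilon h H B L IHL].
  - apply chain_nil, steps_subst, H.
  - exact (chain_bar h (steps_subst sigma H) (bar_subst _ h sigma _ _ B) IHL). }
set (P := fun s t => exists u u', red W delta u u' /\ subst_image R u u' s t).
assert (L : forall u u', red W delta u u' ->
  forall s t, subst_image R u u' s t ->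
  layered delta P s t).
{ refine (red_of_ind _); clear u u' s t; intros m u u1 u' H L s t I.
  destruct I as [sigma tau Hn Es Et].
  (* The whole chain is carried out under [sigma]; [tau] enters only in the [bar] part that
     follows. *)
  assert (C : chain W delta m s (subst_abc sigma u1)).
  { exact (chain_steps_l (star_refl _ _ _ Es) (chain_subst _ sigma _ _ H)). }
  destruct (subst_image_lifted
    (K' := fun i w w' => (i = true /\ P w w') \/
       layered delta P w w') HR Hn Et L) as [E|L'].
  (* Coinduction at a premiss labelled true, the hypothesis of [red_of_ind] at one labelled
     false. *)
  - intros [] v v' w w' [Hr Hi] I; [left | right; auto].
    split; [reflexivity|]; now exists v, v'.
  - apply red_layer_done.
    exact (red_chain_l C (substitutive_red HR E)).
  - exact (red_layer_step C L'). }
intros Hr I; apply (red_of_coind (P := P)).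
- intros w w' (v & v' & Hv & J); exact (L _ _ Hv _ _ J).
- exact (L _ _ Hr _ _ I).
Qed.

(** This is [red_subst] for the identity substitution, since images are closed under [bisim] on the
    right. *)
Lemma red_bisim_r delta s t t' :
  red W delta s t -> bisim t t' -> red W delta s t'.
Proof.
intros H E; apply (red_subst (bisim_substitutive delta) H).
exists (var_abc a b c) (var_abc a b c).
- intros n; apply bisim_refl.
- apply bisim_sym, subst_id; intros n; apply bisim_refl.
- apply bisim_sym; eapply bisim_trans; [|exact E].
  apply subst_id; intros n; apply bisim_refl.
Qed.

Lemma red_ren delta xi s t :
  red W delta s t -> red W delta (ren_abc xi s) (ren_abc xi t).
Proof.
intros H; apply (red_subst (bisim_substitutive delta) H).
exists (fun n => var_abc a b c (xi n)) (fun n => var_abc a b c (xi n));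
  intros; try apply bisim_refl;
  apply bisim_sym, subst_vars; intros n; apply bisim_refl.
Qed.

Lemma red_substitutive delta : substitutive delta (red W delta).
Proof.
split.
- trivial.
- intros s s' t t' E H F; exact (red_bisim_l E (red_bisim_r H F)).
- intros s t; apply red_ren.
- intros n; apply red_bisim, bisim_refl.
Qed.

(** * Contraction of a redex in the target of a reduction *)

Lemma bar_lower_trans delta epsilon s t u :
  wo_lt W epsilon delta -> bar W epsilon s t -> bar W delta t u ->
  bar W delta s u.
Proof.
intros e.
(* A reduction at level [epsilon] is a chain, also valid at level [delta], followed by a [bar] step
   that becomes one more link. Hence only the outermost rules of the two [bar] derivations have to
   be matched. *)
assert (red_lower_trans : forall s t t' u, bisim t t' ->
  red W epsilon s t -> red W delta t' u -> red W delta s u).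
{ clear s t u; intros s t t' u E H K.
  apply redE in H as (m & s' & H & B).
  apply (red_chain_l (chain_mono e H)).
  apply (red_chain_l (m := 1) (s' := t')); [|exact K].
  apply (chain_bar e (steps_refl s') B), chain_nil, star_refl, E. }
intros H K; apply barE in H; apply barE in K; apply barE.
destruct H as [n es et|v v' es et H|v v' w w' es et H H'];
  destruct K as [n' et' eu|x x' et' eu K|x x' y y' et' eu K K'];
  rewrite et in et'; try discriminate et'.
- injection et' as <-; exact (lifted_var _ es eu).
- injection et' as E; apply (lifted_lam es eu).
  apply (red_lower_trans _ v' x _); auto; rewrite E; apply bisim_refl.
- injection et' as E F; apply (lifted_app es eu).
  + apply (red_lower_trans _ v' x _); auto; rewrite E; apply bisim_refl.
  + apply (red_lower_trans _ w' y _); auto; rewrite F; apply bisim_refl.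
Qed.

Lemma propP_red delta s t :
  propP a b c W delta -> red W delta s t ->
  exists s', steps s s' /\ bar W delta s' t.
Proof.
intros HP H; apply redE in H as (m & s1 & H & B).
destruct (HP _ _ _ H) as (s' & epsilon & e & Hs & K).
exists s'; split; [exact Hs|]; clear H Hs.
induction K as [s' s1 E|s' v s1 H K IH].
- exact (bar_bisim_l E B).
- exact (bar_lower_trans e H (IH B)).
Qed.

(** The contraction takes place between bare terms [x] and [y], bisimilar to [t] and [t'], because
    [beta] does. In each case [propP_red] gives a reduct of [s] the outermost shape of [t], and the
    induction continues in the component that holds the redex. *)
Lemma red_beta delta (x y : term) :
  propP a b c W delta -> beta x y ->
  forall s t t', bisim t x -> bisim y t' -> red W delta s t ->
  exists s', steps s s' /\ red W delta s' t'.
Proof.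
intros HP B; induction B as [p q|p p' B IH|p p' q B IH|p q q' B IH];
  intros s t t' E F H; destruct (propP_red HP H) as (s1 & Hs & K);
  apply barE in K.
- destruct (bisim_app_inv E) as (t1 & t2 & et & E1 & E2).
  destruct K as [n es et'|u u' es et' K|u u' v v' es et' K L];
    rewrite et in et'; try discriminate et'.
  injection et' as Et1 Et2; rewrite Et1 in E1; rewrite Et2 in E2.
  (* So far the function part merely reduces at level [delta] to an abstraction; a second use of
     P_delta exposes an abstraction after finitely many beta steps. *)
  destruct (propP_red HP K) as (u1 & Hu & M); apply barE in M.
  destruct (bisim_lam_inv E1) as (w' & eu' & E3).
  destruct M as [n es' et'|w w0 es' et' M|w w0 z z' es' et' M _];
    rewrite eu' in et'; try discriminate et'.
  injection et' as Ew; rewrite Ew in E3.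
  (* The substitution of [subst0], with values in [abcterm] so that [red_subst] applies. *)
  pose (inst v := fun n => match n with 0 => v | S k => var_abc a b c k end).
  assert (inst_subst0 : forall v x, bisim
    (subst (fun n => tm (inst v n)) x) (subst0 x v)).
  { intros z0 x0; apply bisim_subst; [intros [|n]|]; apply bisim_refl. }
  exists (subst_abc (inst v) w); split.
  + apply (steps_trans Hs), steps_trans with (app_abc (lam_abc w) v).
    * apply steps_trans with (app_abc u v).
      -- apply star_refl; rewrite es; apply bisim_refl.
      -- apply steps_app; [|apply steps_refl].
         apply (steps_trans Hu), star_refl; rewrite es'; apply bisim_refl.
    * apply steps_step; eexists _, _; split; [apply bisim_refl|].
      split; [apply beta_redex | apply bisim_sym, inst_subst0].
  (* Body and argument both reduce at level [delta], by [M] and [L], so the contracta are images of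
     the bodies under [red]-related substitutions. *)
  + apply (red_subst (red_substitutive delta) M).
    exists (inst v) (inst v').
    * intros [|n]; [exact L | apply red_bisim, bisim_refl].
    * apply bisim_refl.
    * eapply bisim_trans; [apply bisim_sym, F|].
      apply bisim_subst; [|apply bisim_sym, E3].
      intros [|n]; [apply bisim_sym, E2 | apply bisim_refl].
- destruct (bisim_lam_inv E) as (t1 & et & E1).
  destruct K as [n es et'|u u' es et' K|u u' v v' es et' K L];
    rewrite et in et'; try discriminate et'.
  injection et' as Et1; rewrite Et1 in E1.
  destruct (bisim_lam_inv (bisim_sym F)) as (t2 & et2 & F1).
  destruct (IH _ _ t2 E1 (bisim_sym F1) K) as (w & Hw & M).
  exists (lam_abc w); split.
  + apply (steps_trans Hs), steps_trans with (lam_abc u).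
    * apply star_refl; rewrite es; apply bisim_refl.
    * now apply steps_lam.
  + apply red_bar, barE; exact (lifted_lam (s := lam_abc w) eq_refl et2 M).
- destruct (bisim_app_inv E) as (t1 & t2 & et & E1 & E2).
  destruct K as [n es et'|u u' es et' K|u u' v v' es et' K L];
    rewrite et in et'; try discriminate et'.
  injection et' as Et1 Et2; rewrite Et1 in E1; rewrite Et2 in E2.
  destruct (bisim_app_inv (bisim_sym F)) as (t3 & t4 & et3 & F1 & F2).
  destruct (IH _ _ t3 E1 (bisim_sym F1) K) as (w & Hw & M).
  exists (app_abc w v); split.
  + apply (steps_trans Hs), steps_trans with (app_abc u v).
    * apply star_refl; rewrite es; apply bisim_refl.
    * apply steps_app; [exact Hw | apply steps_refl].
  + apply red_bar, barE.
    (* The argument of [t'] is only bisimilar to that of [t], hence the use of [red_bisim_r]. *)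
    apply (lifted_app (s := app_abc w v) eq_refl et3 M), (red_bisim_r L).
    exact (bisim_trans E2 (bisim_sym F2)).
- destruct (bisim_app_inv E) as (t1 & t2 & et & E1 & E2).
  destruct K as [n es et'|u u' es et' K|u u' v v' es et' K L];
    rewrite et in et'; try discriminate et'.
  injection et' as Et1 Et2; rewrite Et1 in E1; rewrite Et2 in E2.
  destruct (bisim_app_inv (bisim_sym F)) as (t3 & t4 & et3 & F1 & F2).
  destruct (IH _ _ t4 E2 (bisim_sym F2) L) as (w & Hw & M).
  exists (app_abc u w); split.
  + apply (steps_trans Hs), steps_trans with (app_abc u v).
    * apply star_refl; rewrite es; apply bisim_refl.
    * apply steps_app; [apply steps_refl | exact Hw].
  + apply red_bar, barE.
    apply (lifted_app (s := app_abc u w) eq_refl et3); [|exact M].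
    exact (red_bisim_r K (bisim_trans E1 (bisim_sym F1))).
Qed.

End Levels.

Theorem theorem3p15 (a b c : bool) (W : wellorder) (delta : W)
    (s t t' : abcterm a b c) :
  propP a b c W delta -> red W delta s t -> step t t' ->
  exists s' : abcterm a b c, steps s s' /\ red W delta s' t'.
Proof.
intros HP H (x & y & E & B & F).
exact (red_beta HP B E F H).
Qed.
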